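(* Let $k$ be an integer with $k\geq 2$. If $G$ is a connected graph of order $n\geq k+6$ and size $m\leq \frac{k+3}{2}n+\frac{k-1}{2}$, then $G$ has a minimum $k$-degenerate cut, that is, there is a cut $S$ of $G$ that has minimum cardinality among all cuts of $G$ and for which $G[S]$ is $k$-degenerate.
   Context: All graphs are finite, simple, and undirected. The order of a graph is its number of vertices and its size is its number of edges. For a non-negative integer $k$, a graph $H$ is $k$-degenerate if every non-empty subgraph $H'$ of $H$ has a vertex $u$ of degree $d_{H'}(u)$ at most $k$. A set $S$ of vertices of a graph $G$ is a cut of $G$ if $G-S$ is disconnected (has at least two connected components). A minimum cut of $G$ is a cut of minimum cardinality among all cuts of $G$. A minimum $k$-degenerate cut is a minimum cut $S$ (minimum among all cuts of $G$, not only among the $k$-degenerate ones) such that the induced subgraph $G[S]$ is $k$-degenerate. *)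

(* Defs.v *)
From mathcomp Require Import all_boot.

Set Implicit Arguments.
Unset Strict Implicit.
Unset Printing Implicit Defensive.

(* A simple graph is given by a vertex set [A : {set T}] (or the whole of the
   finite type [T]) and an adjacency relation [e : rel T] which is symmetric,
   irreflexive and, when a vertex set is given, relates vertices of [A] only. *)

Definition edge_set (T : finType) (e : rel T) : {set {set T}} :=
  [set [set x; y] | x in T, y in T & e x y].

Definition degree (T : finType) (e : rel T) (u : T) : nat :=
  #|[set v | e u v]|.

Definition induced (T : finType) (e : rel T) (A : {set T}) : rel T :=
  [rel x y | [&& x \in A, y \in A & e x y]].

Definition connected_graph (T : finType) (e : rel T) : Prop :=
  n_comp e T = 1.

(* [G - S] is the graph on [~: S] with adjacency [induced e (~: S)]; the
   second argument of [n_comp] discards the vertices of [S], which are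
   isolated for that relation. *)
Definition is_cut (T : finType) (e : rel T) (S : {set T}) : Prop :=
  1 < n_comp (induced e (~: S)) (~: S).

Definition is_minimum_cut (T : finType) (e : rel T) (S : {set T}) : Prop :=
  is_cut e S /\ forall S' : {set T}, is_cut e S' -> #|S| <= #|S'|.

(* [(B, f)] is a subgraph, not necessarily induced, of [(A, e)]. *)
Definition is_subgraph (T : finType) (B : {set T}) (f : rel T)
    (A : {set T}) (e : rel T) : Prop :=
  [/\ symmetric f,
      forall x y, f x y -> (x \in B) && (y \in B),
      B \subset A
    & subrel f e].

Definition degenerate (T : finType) (k : nat) (A : {set T}) (e : rel T) : Prop :=
  forall (B : {set T}) (f : rel T),
    is_subgraph B f A e -> B != set0 -> exists2 u, u \in B & degree f u <= k.

Definition is_minimum_degenerate_cut (T : finType) (e : rel T) (k : nat)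
    (S : {set T}) : Prop :=
  is_minimum_cut e S /\ degenerate k S (induced e S).

(* Main.v *)
Require Import Defs.
From mathcomp Require Import all_boot all_order all_algebra.
From mathcomp Require Import zify lra.
Import Order.TTheory GRing.Theory Num.Theory.

Set Implicit Arguments.
Unset Strict Implicit.
Unset Printing Implicit Defensive.

(* Some vertex has degree at most k+3, so minimum cuts have at most k+3
   vertices.  A set that is not k-degenerate contains a nonempty "dense" set B
   of minimum degree > k, hence has at least k+2 vertices.  If every minimum
   cut is dense, two cases remain.

   Cuts of size c = k+2: every minimum cut is a clique, so the graph is obtained
   by gluing along c-cliques pieces that are K_{c+1} or have minimum degree at
   least c+1.  Gluing adds 2c to (degree sum) - (c+1)(order), and from order c+4
   on this quantity exceeds c-3, contradicting the size bound.

   Cuts of size k+3: all but k-1 vertices have degree exactly k+3.  If v is such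
   a vertex, N(v) is a minimum cut containing a dense set B, and at least three
   vertices u_1, u_2, u_3 of B have degree k+3; each has exactly one neighbour
   r_i outside N(v) + v, exactly k+1 neighbours in N(v), and the r_i are
   distinct.  Then N(v) - u_1 + r_1 is also a minimum cut, hence contains a dense
   set B'.  If r_1 is in B', it is adjacent to u_2 or u_3, contradicting that the
   r_i are distinct; otherwise B' = N(v) - u_1 already provides the k+1
   neighbours of u_2 and u_3, so u_1 is adjacent to neither and has too few
   neighbours in N(v). *)

Section Neighbours.

Variables (T : finType) (e : rel T).
Implicit Types (u v x y : T) (A B S X : {set T}).

(** * Neighbourhoods, cliques and dense sets *)

Definition nbr (u : T) (A : {set T}) : {set T} := [set v in A | e u v].

Lemma in_nbr u A v : (v \in nbr u A) = (v \in A) && e u v.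
Proof. by rewrite inE. Qed.

Lemma nbr_subset u A : nbr u A \subset A.
Proof. by apply/subsetP=> v; rewrite in_nbr => /andP[]. Qed.

Lemma nbrS u A B : A \subset B -> nbr u A \subset nbr u B.
Proof.
by move=> sAB; apply/subsetP=> v; rewrite !in_nbr => /andP[/(subsetP sAB)-> ->].
Qed.

Lemma card_nbrU u A B : [disjoint A & B] ->
  #|nbr u (A :|: B)| = #|nbr u A| + #|nbr u B|.
Proof.
move=> dAB; have -> : nbr u (A :|: B) = nbr u A :|: nbr u B.
  by apply/setP=> v; rewrite !inE andb_orl.
rewrite cardsU [_ :&: _](_ : _ = set0) ?cards0 ?subn0 //.
apply/setP=> v; rewrite !inE; apply/negP=> /andP[/andP[vA _] /andP[vB _]].
by rewrite (disjointFr dAB vA) in vB.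
Qed.

(** Twice the size of [G[A]], counted vertex by vertex. *)
Definition degree_sum (A : {set T}) : nat := \sum_(u in A) #|nbr u A|.

Definition clique (A : {set T}) : Prop :=
  {in A &, forall x y, x != y -> e x y}.

(** Boolean witness against [k]-degeneracy. Induced subgraphs suffice, since deleting edges only
    lowers degrees. *)
Definition dense (k : nat) (S : {set T}) : bool :=
  [exists B : {set T}, [&& B \subset S, B != set0 &
                          [forall u in B, k < #|nbr u B|]]].

Lemma denseP k S :
  reflect (exists B : {set T}, [/\ B \subset S, B != set0 &
             {in B, forall u, k < #|nbr u B|}])
          (dense k S).
Proof.
apply: (iffP existsP) => -[B].
  by case/and3P=> sBS nB /forall_inP dB; exists B.
by case=> sBS nB dB; exists B; rewrite sBS nB; apply/forall_inP.
Qed.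

Lemma degenerate_nondense k S : ~~ dense k S -> degenerate k S (induced e S).
Proof.
move=> ndS B f [_ fB sBS sfe] nB.
have /forall_inPn[u uB] : ~~ [forall u in B, k < #|nbr u B|].
  by apply: contra ndS => dB; apply/existsP; exists B; rewrite sBS nB.
rewrite -leqNgt => du; exists u => //; apply: leq_trans du.
apply: subset_leq_card; apply/subsetP=> v; rewrite !inE => fuv.
by have /and3P[_ _ ->] := sfe _ _ fuv; case/andP: (fB _ _ fuv) => _ ->.
Qed.

(** * Separations and their correspondence with cuts *)

(** [X] is a union of components of [G[A] - S]; properness leaves a vertex on the other side. *)
Definition separates (A S X : {set T}) : bool :=
  [&& X != set0, [disjoint X & S], X :|: S \proper A &
      [forall x in X, forall y in A, e x y ==> (y \in X :|: S)]].

Lemma separatesP A S X :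
  reflect [/\ X != set0, [disjoint X & S], X :|: S \proper A &
            forall x y, x \in X -> y \in A -> e x y -> y \in X :|: S]
          (separates A S X).
Proof.
apply: (iffP and4P) => -[nX dXS pA cX]; split=> //.
  by move=> x y xX yA; move: cX => /forall_inP/(_ x xX)/forall_inP/(_ y yA)/implyP.
apply/forall_inP=> x xX; apply/forall_inP=> y yA; apply/implyP; exact: cX.
Qed.

Hypotheses (e_sym : symmetric e) (e_irr : irreflexive e).

Lemma nbr_notin u A : u \notin nbr u A.
Proof. by rewrite in_nbr e_irr andbF. Qed.

Lemma nbr_subD1 u A : nbr u A \subset A :\ u.
Proof. by rewrite subsetD1 nbr_subset nbr_notin. Qed.

Lemma card_nbr_lt u (A : {set T}) : u \in A -> #|nbr u A| < #|A|.
Proof.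
move=> uA; rewrite [ltnRHS](cardsD1 u) uA.
exact: subset_leq_card (nbr_subD1 u A).
Qed.

Lemma nbr_full u A v : u \in A -> #|A| <= #|nbr u A|.+1 ->
  v \in A -> v != u -> e u v.
Proof.
move=> uA; rewrite (cardsD1 u A) uA add1n ltnS => cA vA nvu.
have /eqP eqN : nbr u A == A :\ u by rewrite eqEcard nbr_subD1.
have : v \in nbr u A by rewrite eqN !inE nvu.
by rewrite in_nbr => /andP[].
Qed.

Lemma card_dense k (B : {set T}) : B != set0 ->
  {in B, forall u, k < #|nbr u B|} -> k.+2 <= #|B|.
Proof. by case/set0Pn=> u uB dB; apply: leq_trans (card_nbr_lt uB); exact: dB. Qed.

Lemma dense_card k S : dense k S -> k.+2 <= #|S|.
Proof.
case/denseP=> B [sBS nB dB].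
by apply: leq_trans (subset_leq_card sBS); apply: card_dense.
Qed.

(** A dense witness has at least [k+2] vertices, so here it is all of [S], and each vertex is
    adjacent to the [k+1] others. *)
Lemma dense_clique k S : dense k S -> #|S| = k.+2 -> clique S.
Proof.
case/denseP=> B [sBS nB dB] cS.
have /eqP eqB : B == S by rewrite eqEcard sBS cS card_dense.
subst B => x y xS yS nxy.
by apply: (@nbr_full _ S) => //; rewrite 1?eq_sym // cS ltnS dB.
Qed.

Lemma cardsU_disjoint A B : [disjoint A & B] -> #|A :|: B| = #|A| + #|B|.
Proof. by rewrite cardsU -setI_eq0 => /eqP->; rewrite cards0 subn0. Qed.

Lemma separates_sym A S X : separates A S X -> separates A S (A :\: (X :|: S)).
Proof.
case/separatesP=> nX dXS pA cX; have [sA nA] := properP pA.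
have sSA : S \subset A by apply: subset_trans sA; apply: subsetUr.
apply/separatesP; split.
- by case: nA => y yA nyXS; apply/set0Pn; exists y; rewrite !inE in nyXS *; rewrite nyXS yA.
- rewrite -setI_eq0; apply/eqP/setP=> y; rewrite !inE.
  by case: (y \in S); rewrite ?orbT ?andbF.
- have /set0Pn[x xX] := nX; apply/properP; split.
    by apply/subUsetP; split=> //; apply: subsetDl.
  exists x; first by apply: (subsetP sA); rewrite inE xX.
  by rewrite !inE xX /= (disjointFr dXS xX).
- move=> x y; rewrite !inE => /andP[nxXS xA] yA exy; rewrite yA andbT.
  case yS: (y \in S); rewrite ?orbT // !orbF.
  apply: contra nxXS => yX; rewrite -in_setU; apply: (cX y) => //.
  by rewrite e_sym.
Qed.

Lemma is_cutP S : reflect (exists X, separates setT S X)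
  (1 < n_comp (induced e (~: S)) (~: S)).
Proof.
set r := induced e (~: S).
have r_sym : symmetric r by move=> x y; rewrite /r /induced /= e_sym andbCA.
have c_sym : connect_sym r by apply: sym_connect_sym.
have clS : closed r (~: S).
  by move=> x y /and3P[xS yS _]; rewrite xS yS.
apply: (iffP idP).
- rewrite /n_comp_mem; case/card_gt1P=> x [y [] ]; rewrite !inE.
  move=> /andP[rx xS] /andP[ry yS] nxy.
  (* One side is the component of [x]; the distinct root [y] lies outside it. *)
  exists [set z in ~: S | connect r x z]; apply/separatesP; split.
  + by apply/set0Pn; exists x; rewrite !inE xS connect0.
  + by rewrite -setI_eq0; apply/eqP/setP=> z; rewrite !inE; case: (z \in S); rewrite ?andbF.
  + rewrite properEneq subsetT andbT; apply/eqP=> /setP/(_ y).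
    rewrite !inE yS (negPf yS) orbF /= => /(fingraph.rootP c_sym).
    by rewrite (eqP rx) (eqP ry) => /eqP; rewrite (negPf nxy).
  + move=> z t; rewrite !inE => /andP[zS xz] _ ezt.
    case tS: (t \in S); rewrite ?orbT //= orbF.
    by apply: connect_trans xz (connect1 _); rewrite /r /induced /= !inE zS tS.
- case=> X /separatesP[/set0Pn[x xX] dXS pT cX].
  have [_ [y _]] := properP pT; rewrite inE negb_or => /andP[yX yS].
  have xS : x \notin S by rewrite (disjointFr dXS xX).
  have clX : closed r X.
    apply: intro_closed => // z t /and3P[_ tS ezt] zX.
    by have := cX _ _ zX (in_setT t) ezt; move: tS; rewrite !inE; case: (t \in S); rewrite ?orbF.
  apply/card_gt1P; exists (fingraph.root r x); exists (fingraph.root r y).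
  rewrite !inE !roots_root //; split.
  + by have := closed_connect clS (connect_root r x); rewrite !inE xS => <-.
  + by have := closed_connect clS (connect_root r y); rewrite !inE yS => <-.
  + apply/eqP=> /(fingraph.rootP c_sym)/(closed_connect clX).
    by rewrite xX (negPf yX).
Qed.

(** * Degree sum and size *)

Lemma degree_sum_edge_set : degree_sum setT <= 2 * #|edge_set e|.
Proof.
rewrite /degree_sum.
have -> : \sum_(u in setT) #|nbr u setT| = \sum_u #|nbr u setT|.
  by apply: eq_bigl => u; rewrite inE.
(* Neighbours [v] of [u] inject into the edges at [u] by [[set u; v]]; exchanging the sums then
   counts each edge at most twice. *)
apply: (@leq_trans (\sum_u #|[set E in edge_set e | u \in E]|)).
  apply: leq_sum => u _.
  have inj : {in nbr u setT &, injective (fun v => [set u; v])}.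
    move=> v w; rewrite !in_nbr => /andP[_ uv] /andP[_ uw] /setP/(_ v).
    rewrite !inE eqxx orbT; case: eqVneq => [vu|_ /esym/eqP //].
    by rewrite vu e_irr in uv.
  rewrite -(card_in_imset inj); apply: subset_leq_card.
  apply/subsetP=> E /imsetP[v]; rewrite in_nbr => /andP[_ uv] ->.
  rewrite !inE eqxx andbT; apply/imset2P; exists u v; rewrite ?inE //=.
have -> : \sum_u #|[set E in edge_set e | u \in E]|
    = \sum_(E in edge_set e) #|E|.
  under eq_bigr do rewrite -sum1_card.
  under [RHS]eq_bigr do rewrite -sum1_card.
  rewrite (exchange_big_dep (mem (edge_set e))) /=.
    by apply: eq_bigr => E EE; apply: eq_bigl => u; rewrite inE EE.
  by move=> u E _; rewrite inE => /andP[].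
rewrite mulnC -sum_nat_const; apply: leq_sum => E /imset2P[x y _ _ ->].
by rewrite cards2; case: (x != y).
Qed.

(** * Gluing along cliques *)

(* Every separator of [G[A]] has at least [c] vertices, and those with exactly
   [c] vertices are cliques. *)
Definition clique_separated (c : nat) (A : {set T}) : Prop :=
  forall S X, separates A S X -> c <= #|S| /\ (#|S| = c -> clique S).

(* A clique [S] cannot meet both sides of a separation of [X :|: S], so that
   separation extends to [A]. *)
Lemma clique_separated_part c A S X : clique_separated c A ->
  separates A S X -> clique S -> clique_separated c (X :|: S).
Proof.
move=> PA /separatesP[nX dXS pA cX] clS.
have ext S' X' : separates (X :|: S) S' X' -> [disjoint S & X'] ->
    c <= #|S'| /\ (#|S'| = c -> clique S').
  case/separatesP=> nX' dXS' pA' cX' dSX'.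
  apply: (PA S' X'); apply/separatesP; split=> //.
    exact: proper_trans pA' pA.
  move=> x y xX' yA exy; have xXS : x \in X :|: S.
    by apply: (subsetP (proper_sub pA')); rewrite inE xX'.
  have xX : x \in X by move: xXS; rewrite inE (disjointFl dSX' xX') orbF.
  exact: cX' (cX _ _ xX yA exy) exy.
(* If [S] meets [X'], it misses the opposite side, so the swapped separation is extended instead. *)
move=> S' X' sep'; case: (boolP [disjoint S & X']) => [|ndis]; first exact: ext.
apply: (ext _ _ (separates_sym sep')).
have [_ _ _ cX'] := separatesP _ _ _ sep'.
move: ndis; rewrite -setI_eq0 => /set0Pn[s]; rewrite inE => /andP[sS sX'].
rewrite -setI_eq0; apply/eqP/setP=> t; rewrite !inE.
apply/negP=> /and3P[tS ntX' _]; case/negP: ntX'; rewrite -in_setU.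
have [<-|nst] := eqVneq s t; first by rewrite inE sX'.
by apply: (cX' s) => //; [rewrite inE tS orbT | apply: clS].
Qed.

(** Vertices off [S] keep their whole neighbourhood in one piece; for those in [S],
    inclusion-exclusion counts the neighbours in [S] twice. *)
Lemma degree_sum_glue A S X : separates A S X ->
  degree_sum A + degree_sum S
  = degree_sum (X :|: S) + degree_sum (A :\: (X :|: S) :|: S).
Proof.
move=> sepX; have sepY := separates_sym sepX.
have [_ dXS pA cX] := separatesP _ _ _ sepX.
have [_ dYS _ cY] := separatesP _ _ _ sepY.
have sA := proper_sub pA.
have nXE u : u \in X -> nbr u A = nbr u (X :|: S).
  move=> uX; apply/setP=> v; rewrite !in_nbr; case euv: (e u v); rewrite ?andbF // !andbT.
  by apply/idP/idP=> [vA|/(subsetP sA) //]; apply: cX euv.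
set Y := A :\: (X :|: S) in sepY dYS cY *.
have sYSA : Y :|: S \subset A.
  by rewrite subUset subsetDl; apply: subset_trans sA; apply: subsetUr.
have nYE u : u \in Y -> nbr u A = nbr u (Y :|: S).
  move=> uY; apply/setP=> v; rewrite !in_nbr; case euv: (e u v); rewrite ?andbF // !andbT.
  by apply/idP/idP=> [vA|/(subsetP sYSA) //]; apply: cY euv.
have dXY : [disjoint X & Y :|: S].
  rewrite -setI_eq0; apply/eqP/setP=> v; rewrite !inE.
  by case: (boolP (v \in X)) => //= vX; rewrite (disjointFr dXS vX).
have eqA : A = X :|: (Y :|: S).
  apply/setP=> v; rewrite !inE; have := subsetP sA v; rewrite inE.
  by case: (v \in X); case: (v \in S); case: (v \in A) => //= ->.
clearbody Y.
have nSE u : #|nbr u A| + #|nbr u S| = #|nbr u (X :|: S)| + #|nbr u (Y :|: S)|.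
  rewrite -[RHS]cardsUI; congr (_ + _); apply: eq_card => v.
    by rewrite eqA !inE; case: (v \in X); case: (v \in S); case: (v \in Y); case: (e u v).
  have := disjointFr dXY (x := v); rewrite !inE.
  by case: (v \in X); case: (v \in S); case: (v \in Y); case: (e u v) => // /(_ isT).
have sumU (f : T -> nat) (B C : {set T}) : [disjoint B & C] ->
    \sum_(u in B :|: C) f u = \sum_(u in B) f u + \sum_(u in C) f u.
  by move=> dBC; rewrite -bigU //=; apply: eq_bigl => u; rewrite !inE.
rewrite /degree_sum {1}eqA !sumU //.
have sX : \sum_(u in X) #|nbr u A| = \sum_(u in X) #|nbr u (X :|: S)|.
  by apply: eq_bigr => u /nXE->.
have sY : \sum_(u in Y) #|nbr u A| = \sum_(u in Y) #|nbr u (Y :|: S)|.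
  by apply: eq_bigr => u /nYE->.
rewrite sX sY.
have : \sum_(u in S) #|nbr u A| + \sum_(u in S) #|nbr u S|
    = \sum_(u in S) #|nbr u (X :|: S)| + \sum_(u in S) #|nbr u (Y :|: S)|.
  by rewrite -!big_split; apply: eq_bigr.
lia.
Qed.

Lemma degree_sum_ge d A : {in A, forall u, d <= #|nbr u A|} ->
  d * #|A| <= degree_sum A.
Proof. by move=> dA; rewrite mulnC -sum_nat_const; apply: leq_sum. Qed.

Lemma degree_sum_le A : degree_sum A + #|A| <= #|A| * #|A|.
Proof.
rewrite -[X in _ + X]sum1_card -big_split -sum_nat_const; apply: leq_sum => u uA.
by rewrite /= addn1; apply: card_nbr_lt.
Qed.

Lemma separates_nbr A u : u \in A -> #|nbr u A|.+1 < #|A| ->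
  separates A (nbr u A) [set u].
Proof.
move=> uA ltA; apply/separatesP; split.
- by apply/set0Pn; exists u; rewrite inE.
- by rewrite disjoints1 nbr_notin.
- rewrite properEcard subUset sub1set uA nbr_subset /=.
  by rewrite cardsU1 nbr_notin.
- by move=> x y /set1P-> yA exy; rewrite inE in_nbr yA exy orbT.
Qed.

(** Induction on [#|A|], tracking the excess of the degree sum over [(c+1) * #|A|]: at least
    [-(c+1)] at order [c+1], [-2] from order [c+2], [-1] from [c+3], and [c-2] from [c+4] if a
    [c]-separator exists. Gluing adds at least [2c]: orders [c+1] and [c+1] give [-2], while [c+1]
    and [c+2] give [c-3], at least [-1] as [c > 1]. *)
Lemma clique_separated_degree_sum c A : 1 < c -> clique_separated c A -> c < #|A| ->
  [/\ c * #|A| <= degree_sum A,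
      c.+1 < #|A| -> c.+1 * #|A| <= degree_sum A + 2,
      c.+2 < #|A| -> c.+1 * #|A| <= degree_sum A + 1 &
      c.+3 < #|A| -> (exists S X, separates A S X /\ #|S| = c) ->
        c.+1 * #|A| + c <= degree_sum A + 2].
Proof.
move=> c_gt1; have [n] := ubnP #|A|; elim: n => // n IHn in A *.
rewrite ltnS => leAn PA ltcA.
have degA u : u \in A -> c <= #|nbr u A|.
  move=> uA; have [ltA|] := ltnP #|nbr u A|.+1 #|A|; last by lia.
  by have [] := PA _ _ (separates_nbr uA ltA).
case: (boolP [exists S : {set T}, exists X : {set T}, separates A S X && (#|S| == c)]).
- case/existsP=> S /existsP[X] /andP[sepX /eqP cS].
  have [_ /(_ cS) clS] := PA _ _ sepX.
  have sepY := separates_sym sepX.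
  have P1 := clique_separated_part PA sepX clS.
  have P2 := clique_separated_part PA sepY clS.
  have glue := degree_sum_glue sepX.
  have leS := degree_sum_le S.
  have [nX dXS pA _] := separatesP _ _ _ sepX.
  have [nY dYS _ _] := separatesP _ _ _ sepY.
  have c1 : #|X :|: S| = #|X| + c by rewrite cardsU_disjoint ?cS.
  have c2 : #|A :\: (X :|: S) :|: S| = #|A :\: (X :|: S)| + c.
    by rewrite cardsU_disjoint ?cS.
  have cA : #|A| = #|A :\: (X :|: S)| + (#|X| + c).
    rewrite -c1 -(cardsID (X :|: S) A) addnC; congr (_ + _).
    by rewrite (setIidPr (proper_sub pA)).
  rewrite -!card_gt0 in nX nY.
  have [||D1 E1 F1 _] := IHn _ _ P1; [lia | lia |].
  have [||D2 E2 F2 _] := IHn _ _ P2; [lia | lia |].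
  move: D1 E1 F1 D2 E2 F2 glue leS; rewrite c1 c2 cA cS.
  move: #|X| #|A :\: _| nX nY => [//|a] [//|b] _ _.
  move: (degree_sum _) (degree_sum _) (degree_sum _) (degree_sum _).
  move=> DA DS DX DY D1 E1 F1 D2 E2 F2 glue leS.
  split; nia.
(* A vertex of degree [c] would have a [c]-separator as its neighbourhood, so all degrees are at
   least [c+1]. *)
- move=> nsep; have degA1 : c.+1 < #|A| -> c.+1 * #|A| <= degree_sum A.
    move=> lt1; apply: degree_sum_ge => u uA.
    rewrite ltn_neqAle degA // andbT; apply: contra nsep => /eqP cu.
    apply/existsP; exists (nbr u A); apply/existsP; exists [set u].
    by rewrite separates_nbr -?cu // eqxx.
  split.
  + exact: degree_sum_ge.
  + by move=> /degA1 le1; apply: leq_trans le1 (leq_addr _ _).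
  + by move=> /ltnW/degA1 le1; apply: leq_trans le1 (leq_addr _ _).
  + move=> _ [S [X [sepX cS]]]; case/existsP: nsep.
    by exists S; apply/existsP; exists X; rewrite sepX cS eqxx.
Qed.

(** * Minimum cuts of size [k+2] *)

Lemma no_dense_min_cuts_k2 k : 0 < k -> k + 6 <= #|T| ->
  degree_sum setT <= k.+3 * #|T| + k.-1 ->
  (exists S X, separates setT S X /\ #|S| = k.+2) ->
  (forall S X, separates setT S X -> k.+2 <= #|S|) ->
  (forall S X, separates setT S X -> #|S| = k.+2 -> dense k S) -> False.
Proof.
move=> k_gt0 leT leD exS minS denseS.
have PT : clique_separated k.+2 setT.
  move=> S X sepS; split=> [|cS]; first exact: minS sepS.
  exact: dense_clique (denseS _ _ sepS cS) cS.
(* For [c = k+2] the last bound puts the degree sum at [(k+3)n + k] or more, exceeding the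
   hypothesis by one; it applies as [c+4 = k+6]. *)
have [||_ _ _ /(_ _ exS)] := clique_separated_degree_sum _ PT; rewrite ?cardsT; lia.
Qed.

(** * Minimum cuts of size [k+3] *)

Lemma no_dense_min_cuts_k3 k : 0 < k -> k + 6 <= #|T| ->
  degree_sum setT <= k.+3 * #|T| + k.-1 ->
  (forall S X, separates setT S X -> k.+3 <= #|S|) ->
  (forall S X, separates setT S X -> #|S| = k.+3 -> dense k S) -> False.
Proof.
move=> k_gt0 leT leD minS denseS.
pose H := [set u | #|nbr u setT| != k.+3].
have deg_ge u : k.+3 <= #|nbr u setT|.
  have [ltu|] := ltnP #|nbr u setT|.+1 #|[set: T]|; last by rewrite cardsT; lia.
  by apply: minS (separates_nbr _ ltu); rewrite inE.
(* All degrees are at least [k+3], so each vertex of [H] uses up at least one unit of the surplus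
   [k-1]. *)
have cH : #|H| <= k.-1.
  suff : k.+3 * #|T| + #|H| <= degree_sum setT by lia.
  rewrite -sum1_card /H; under eq_bigl do rewrite inE.
  rewrite big_mkcond /= mulnC -sum_nat_const -big_split /degree_sum /=.
  rewrite [leqRHS](eq_bigl xpredT); last by move=> u; rewrite inE.
  apply: leq_sum => u _; have := deg_ge u; case: eqP => /=; lia.
have [v vH] : exists v, v \notin H.
  apply/existsP; rewrite -negb_forall; apply/negP=> /forallP allH.
  have : #|T| <= #|H| by rewrite -cardsT; apply: subset_leq_card; apply/subsetP=> u _.
  by lia.
pose N := nbr v setT; pose R := ~: (v |: N).
have cN : #|N| = k.+3 by move: vH; rewrite inE negbK => /eqP.
have vN : v \notin N by apply: nbr_notin.
have cR : 1 < #|R|.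
  by have := cardsC (v |: N); rewrite -/R cardsU1 vN cN; lia.
have dNR : [disjoint N & R].
  by rewrite -setI_eq0; apply/eqP/setP=> x; rewrite !inE; case: (e v x); rewrite ?orbT.
have dvNR : [disjoint [set v] & N :|: R].
  by rewrite disjoints1 !inE eqxx /= e_irr.
have coverT : [set: T] = [set v] :|: (N :|: R).
  by apply/setP=> x; rewrite !inE; case: (x == v); case: (e v x).
have deg_split u : u \in N ->
    #|nbr u setT| = 1 + (#|nbr u N| + #|nbr u R|).
  rewrite inE in_setT /= => vu; rewrite coverT !card_nbrU //; congr (_ + _).
  have -> : nbr u [set v] = [set v]; last by rewrite cards1.
  by apply/setP=> x; rewrite !inE; case: eqVneq => //= ->; rewrite e_sym vu.
(* Exchange: [U] joins [v] on its side, and a set [M] containing the neighbours of [U] in [R]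
   replaces [U] in the cut. A vertex of [R] outside [M] remains on the far side. *)
have sep (U M : {set T}) : U \subset N -> M \subset R -> {in U, forall u, nbr u R \subset M} ->
    #|M| < #|R| ->
    separates setT (N :\: U :|: M) (v |: U) /\ #|N :\: U :|: M| + #|U| = k.+3 + #|M|.
  move=> sUN sMR nU ltM; split; last first.
    rewrite cardsU_disjoint; last first.
      apply: disjointWl (subsetDl _ _) _; exact: disjointWr sMR dNR.
    have := subset_leq_card sUN; rewrite cardsD (setIidPr sUN) cN; lia.
  have vM : v \notin M by apply/negP=> /(subsetP sMR); rewrite !inE eqxx.
  apply/separatesP; split.
  - by apply/set0Pn; exists v; rewrite !inE eqxx.
  - rewrite -setI_eq0; apply/eqP/setP=> x; rewrite !(in_setI, in_setU, in_set1, in_setD, in_set0).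
    apply/negP=> /andP[/orP[/eqP->|xU]]; first by rewrite (negPf vN) (negPf vM) andbF.
    rewrite xU /= => /(subsetP sMR).
    by rewrite (disjointFr dNR (subsetP sUN _ xU)).
  - have [y yR yM] : exists2 y, y \in R & y \notin M.
      apply/subsetPn; apply/negP=> /subset_leq_card; lia.
    rewrite properEneq subsetT andbT; apply/eqP=> /setP/(_ y); rewrite in_setT => /idP.
    move: (yR); rewrite in_setC in_setU1 => /norP[yv yN].
    rewrite !(in_setU, in_set1, in_setD) (negPf yv) (negPf yN) (negPf yM) andbF !orbF /=.
    by move=> /(subsetP sUN); rewrite (negPf yN).
  - move=> x y; rewrite !(in_setU, in_set1, in_setD) => xU _ exy.
    case: (eqVneq y v) => //= yv; case yU: (y \in U) => //=.
    case yN: (y \in N) => //=; case/orP: xU => [/eqP xv|xU].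
      by move: yN; rewrite in_nbr -xv exy in_setT.
    apply: (subsetP (nU x xU)); rewrite in_nbr exy andbT.
    by rewrite in_setC in_setU1 negb_or yv yN.
(* Otherwise deleting [u] from [N] would leave a cut of size [k+2]. *)
have outR u : u \in N -> 0 < #|nbr u R|.
  move=> uN; rewrite lt0n; apply/negP=> /eqP/cards0_eq nu.
  have [||||/minS] := sep [set u] set0; rewrite ?sub0set ?sub1set ?cards0 ?cards1 //; try lia.
  by move=> x /set1P->; rewrite nu.
have sepv : separates setT N [set v].
  by apply: separates_nbr; rewrite // cardsT -/N cN; lia.
have /denseP[B [sBN nB dB]] := denseS _ _ sepv cN.
have cB := card_dense nB dB.
pose L := B :\: H.
(* [B] has at least [k+2] vertices and [H] at most [k-1]. *)
have cL : 2 < #|L|.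
  have := subset_leq_card (subsetIr B H); rewrite /L cardsD; lia.
(* The degree [k+3] splits as 1 for [v], at least [k+1] in [N] and at least 1 in [R], so equality
   holds throughout. *)
have degL u : u \in L -> [/\ u \in N, #|nbr u N| = k.+1 & #|nbr u R| = 1].
  rewrite inE => /andP[uH uB]; have uN := subsetP sBN _ uB.
  have := deg_split _ uN; have := outR _ uN; have := dB _ uB.
  have := subset_leq_card (nbrS u sBN); move: uH; rewrite inE negbK => /eqP->.
  by move: #|nbr u N| #|nbr u B| #|nbr u R|; clear -uN; split=> //; lia.
have [u1 [u2 [u3 [[L1 L2 L3] [n12 n23 n31]]]]] := card_gt2P cL.
have [N1 c1 /eqP/cards1P[r nr]] := degL _ L1.
have rR : r \in R by apply: (subsetP (nbr_subset u1 R)); rewrite nr set11.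
have rN : r \notin N by rewrite (disjointFl dNR rR).
(* Otherwise [u1] and [u] could both be traded for [r] in the cut [N]. *)
have nadj u : u \in L -> u != u1 -> ~~ e u r.
  move=> uL nu1; apply/negP=> eur; have [uN _ /eqP/cards1P[r' nr']] := degL _ uL.
  have /set1P er : r \in [set r'] by rewrite -nr' in_nbr rR eur.
  subst r'.
  have [||||/minS] := sep [set u1; u] [set r].
  - by rewrite subUset !sub1set N1 uN.
  - by rewrite sub1set.
  - by move=> x /set2P[]->; rewrite ?nr ?nr'.
  - by rewrite cards1.
  by rewrite cards2 cards1 eq_sym nu1; move: #|_ :|: _|; clear; lia.
have [||||sep1 cS1] := sep [set u1] [set r].
- by rewrite sub1set.
- by rewrite sub1set.
- by move=> x /set1P->; rewrite nr.
- by rewrite cards1.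
have {sep1 cS1} : dense k (N :\: [set u1] :|: [set r]).
  by apply: denseS sep1 _; move: cS1; rewrite !cards1 !addn1 => -[].
case/denseP=> B1 [sB1 nB1 dB1].
have n21 : u2 != u1 by rewrite eq_sym.
have [N2 c2 _] := degL _ L2; have [N3 c3 _] := degL _ L3.
(* [N'] has only [k] vertices, too few for the neighbours of a vertex within a dense set. *)
pose N' := N :\ u1 :\ u2 :\ u3.
have cN' : #|N'| = k.
  have n32 : u3 != u2 by rewrite eq_sym.
  move: cN; rewrite (cardsD1 u1) N1 (cardsD1 u2) in_setD1 n21 N2.
  by rewrite (cardsD1 u3) !in_setD1 n32 n31 N3 => -[].
have [rB1|rB1] := boolP (r \in B1).
- have : nbr r B1 \subset N'.
    apply/subsetP=> x; rewrite in_nbr => /andP[xB1 erx].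
    have := subsetP sB1 _ xB1; rewrite !(in_setU, in_setD, in_set1).
    have nxr : x != r by apply: contraTneq erx => ->; rewrite e_irr.
    rewrite (negPf nxr) orbF => /andP[-> ->]; rewrite !andbT.
    by apply/andP; split; apply: contraTneq erx => ->; rewrite e_sym nadj.
  by move=> /subset_leq_card; rewrite cN' leqNgt dB1.
- have sB1N : B1 \subset N :\ u1.
    apply/subsetP=> x xB1; have := subsetP sB1 _ xB1.
    rewrite in_setU in_set1 => /orP[//|/eqP xr].
    by move: rB1; rewrite -xr xB1.
  have {sB1N} eB1 : B1 = N :\ u1.
    apply/eqP; rewrite eqEcard sB1N; move: cN.
    by rewrite (cardsD1 u1) N1 add1n => -[->]; exact: card_dense.
  (* Such a [u] has [k+1] neighbours in [B1]; adjacency to [u1] would add another in [N], against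
     [cu]. *)
  have nadj1 u : u \in L -> u != u1 -> ~~ e u1 u.
    move=> uL nu; have [uN cu _] := degL _ uL; apply/negP=> e1u.
    have : nbr u B1 \subset nbr u N :\ u1.
      apply/subsetP=> x; rewrite eB1 !(in_nbr, in_setD1).
      by move=> /andP[/andP[-> ->] ->].
    move=> /subset_leq_card; move: cu.
    rewrite (cardsD1 u1) in_nbr N1 e_sym e1u add1n => -[->].
    by rewrite leqNgt dB1 // eB1 in_setD1 nu.
  have : nbr u1 N \subset N'.
    apply/subsetP=> x; rewrite !(in_nbr, in_setD1) => /andP[-> e1x].
    rewrite andbT; apply/and3P.
    split; apply: contraTneq e1x => ->; by rewrite ?e_irr ?nadj1.
  by move=> /subset_leq_card; rewrite c1 cN' ltnn.
Qed.

(** * Choice of a minimum cut *)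

Lemma min_degenerate_cut k : 1 < k -> k + 6 <= #|T| ->
  degree_sum setT <= k.+3 * #|T| + k.-1 ->
  exists S, is_minimum_degenerate_cut e k S.
Proof.
move=> k_gt1 leT leD.
have k_gt0 := ltnW k_gt1.
have [v lev] : exists v, #|nbr v setT| <= k.+3.
  apply/existsP; rewrite -[X in is_true X]negbK negb_exists; apply/negP=> /forallP gtv.
  have : k.+4 * #|[set: T]| <= degree_sum setT.
    by apply: degree_sum_ge => u _; rewrite ltnNge.
  by rewrite cardsT; nia.
pose iscut S := 1 < n_comp (induced e (~: S)) (~: S).
have cutv : iscut (nbr v setT).
  by apply/is_cutP; exists [set v]; apply: separates_nbr; rewrite // cardsT; lia.
case: (arg_minnP (fun S => #|S|) cutv) => S0 cutS0 minS0.
have le0 : #|S0| <= k.+3 by apply: leq_trans (minS0 _ cutv) lev.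
(* Either some minimum cut is not dense and serves as the answer, or all are dense and [#|S0|] is
   [k+2] or [k+3]. *)
case: (boolP [exists S : {set T}, [&& iscut S, #|S| == #|S0| & ~~ dense k S]]).
  case/existsP=> S /and3P[cutS /eqP cS ndS]; exists S; split.
    by split=> // S'; rewrite cS; apply: minS0.
  exact: degenerate_nondense.
move=> /existsPn nex; exfalso.
have minS S X : separates setT S X -> #|S0| <= #|S|.
  by move=> sepS; apply: minS0; apply/is_cutP; exists X.
have denseS S X : separates setT S X -> #|S| = #|S0| -> dense k S.
  move=> sepS cS; have := nex S; rewrite cS eqxx /=.
  have -> : iscut S by apply/is_cutP; exists X.
  by rewrite negbK.
have /is_cutP[X0 sep0] := cutS0.
have := dense_card (denseS _ _ sep0 erefl).
rewrite leq_eqVlt => /orP[/eqP|] c0.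
  apply: (@no_dense_min_cuts_k2 k) => //; rewrite ?c0 //.
  by exists S0, X0.
have {le0 c0} c0 : #|S0| = k.+3 by lia.
by apply: (@no_dense_min_cuts_k3 k) => //; rewrite -c0.
Qed.

End Neighbours.

(** * From the rational size bound to the degree sum *)

Local Open Scope ring_scope.

Theorem theorem3 (k : nat) (hk : (2 <= k)%N)
    (T : finType) (e : rel T)
    (e_sym : symmetric e) (e_irr : irreflexive e)
    (e_conn : connected_graph e)
    (h_order : (k + 6 <= #|T|)%N)
    (h_size : (#|edge_set e|)%:R <=
       (k%:R + 3) / 2 * (#|T|)%:R + (k%:R - 1) / 2 :> rat) :
  exists S : {set T}, is_minimum_degenerate_cut e k S.
Proof.
apply: min_degenerate_cut => //; apply: leq_trans (degree_sum_edge_set e_irr) _.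
(* Doubling the size bound clears the halves; [k.-1] casts to [k - 1] because [k] is positive. *)
rewrite -(ler_nat rat) natrD !natrM -subn1 natrB; last exact: ltnW.
rewrite -addn3 natrD; lra.
Qed.
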